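(* Let $S$ be a set of sorts, $A$ an $S$-sorted set and $J$ a many-sorted closure operator on $A$ which is $n$-ary, with $n\geq 2$. If $i<j$ with $i,j\in\mathrm{IrB}(A,J)$ are such that $\{i+1,\dots,j-1\}\cap\mathrm{IrB}(A,J)=\emptyset$, then $j-i\leq n-1$. In particular, if $n=2$, then $\mathrm{IrB}(A,J)$ is a convex subset of $\mathbb{N}$.
   Context: An $S$-sorted set is a family $A=(A_s)_{s\in S}$ of sets. For $S$-sorted sets $X,Y$, $X\subseteq Y$ means $X_s\subseteq Y_s$ for all $s$; unions and differences are taken sortwise; $\mathrm{Sub}(A)$ is the set of all $S$-sorted $X\subseteq A$. The cardinal $\mathrm{card}(X)$ is the cardinal of $\bigcup_{s\in S}(X_s\times\{s\})$, and $\mathrm{Sub}_{\leq n}(X)=\{Y\subseteq X\mid\mathrm{card}(Y)\leq n\}$. For $t\in S$ and $x$, $\delta^{t,x}$ is the $S$-sorted set with $\delta^{t,x}_t=\{x\}$ and $\delta^{t,x}_s=\emptyset$ for $s\neq t$. A many-sorted closure operator on $A$ is a map $J:\mathrm{Sub}(A)\to\mathrm{Sub}(A)$ that is extensive, isotone and idempotent. For $n\in\mathbb{N}$ define $J_{\leq n}(X)=\bigcup\{J(Y)\mid Y\in\mathrm{Sub}_{\leq n}(X)\}$, $J^0_{\leq n}=\mathrm{Id}$, $J^{k+1}_{\leq n}=J_{\leq n}\circ J^k_{\leq n}$, $J^\omega_{\leq n}(X)=\bigcup_{m\in\mathbb{N}}J^m_{\leq n}(X)$; $J$ is $n$-ary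 if $J=J^\omega_{\leq n}$. A subset $X\subseteq A$ is irredundant with respect to $J$ if for every $s\in S$ and $x\in X_s$, $x\notin J(X-\delta^{s,x})_s$; it is a basis if $J(X)=A$; an irredundant basis if both. $\mathrm{IrB}(A,J)=\mathbb{N}\cap\{\mathrm{card}(X)\mid X\text{ is an irredundant basis of }A\text{ with respect to }J\}$. *)

(* Defs.v *)
From mathcomp Require Import all_boot.
From mathcomp Require Import boolp classical_sets functions cardinality.

Set Implicit Arguments.
Unset Strict Implicit.
Unset Printing Implicit Defensive.

Local Open Scope classical_set_scope.
Local Open Scope card_scope.

(* An S-sorted set is a family of types A : S -> Type, and msub A is Sub(A). *)
Definition msub (S : Type) (A : S -> Type) : Type := forall s : S, set (A s).

Definition msubset (S : Type) (A : S -> Type) (X Y : msub A) : Prop :=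
  forall s, X s `<=` Y s.

Definition msfull (S : Type) (A : S -> Type) : msub A := fun s => setT.

Definition msdiff (S : Type) (A : S -> Type) (X Y : msub A) : msub A :=
  fun s => X s `\` Y s.

Definition msbigcup (S : Type) (A : S -> Type) (I : Type) (D : set I)
    (F : I -> msub A) : msub A :=
  fun s => \bigcup_(i in D) F i s.

(* The Kronecker delta: {x} at sort t, empty elsewhere. The equality is taken
   in the disjoint union, where it forces s = t. *)
Definition delta (S : Type) (A : S -> Type) (t : S) (x : A t) : msub A :=
  fun s => [set y | existT A s y = existT A t x].

(* The union of the X_s x {s}, whose cardinal is by definition card(X). *)
Definition mstotal (S : Type) (A : S -> Type) (X : msub A) :
    set {s : S & A s} :=
  [set p | X (projT1 p) (projT2 p)].

Definition mscard_eq (S : Type) (A : S -> Type) (X : msub A) (n : nat) : Prop :=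
  mstotal X #= `I_n.

Definition mscard_le (S : Type) (A : S -> Type) (X : msub A) (n : nat) : Prop :=
  mstotal X #<= `I_n.

Definition sub_le (S : Type) (A : S -> Type) (n : nat) (X : msub A) :
    set (msub A) :=
  [set Y | msubset Y X /\ mscard_le Y n].

Record ms_closure (S : Type) (A : S -> Type) (J : msub A -> msub A) : Prop :=
  MsClosure {
    ms_extensive : forall X, msubset X (J X);
    ms_isotone : forall X Y, msubset X Y -> msubset (J X) (J Y);
    ms_idempotent : forall X, J (J X) = J X
  }.

Definition J_le (S : Type) (A : S -> Type) (J : msub A -> msub A) (n : nat)
    (X : msub A) : msub A :=
  msbigcup (sub_le n X) J.

Definition J_le_omega (S : Type) (A : S -> Type) (J : msub A -> msub A)
    (n : nat) (X : msub A) : msub A :=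
  msbigcup [set: nat] (fun m => iter m (J_le J n) X).

Definition n_ary (S : Type) (A : S -> Type) (n : nat)
    (J : msub A -> msub A) : Prop :=
  J = J_le_omega J n.

Definition irredundant (S : Type) (A : S -> Type) (J : msub A -> msub A)
    (X : msub A) : Prop :=
  forall (s : S) (x : A s), X s x -> ~ J (msdiff X (delta x)) s x.

Definition basis (S : Type) (A : S -> Type) (J : msub A -> msub A)
    (X : msub A) : Prop :=
  J X = @msfull S A.

Definition irredundant_basis (S : Type) (A : S -> Type)
    (J : msub A -> msub A) (X : msub A) : Prop :=
  irredundant J X /\ basis J X.

Definition IrB (S : Type) (A : S -> Type) (J : msub A -> msub A) : set nat :=
  [set k | exists X : msub A, irredundant_basis J X /\ mscard_eq X k].

Definition nat_convex (B : set nat) : Prop :=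
  forall i j k : nat, B i -> B j -> i <= k <= j -> B k.

(* Main.v *)
(** Fix irredundant bases of sizes [i < j], the larger one being [B]. Every
    point has a rank, the number of rounds of [J_le J n] needed to reach it from
    [B], and a point of rank [k + 1] lies in the closure of at most [n] points of
    rank at most [k]. Give a point of rank [k] the weight [(n + 1) ^ k]. In a
    generating set of size at most [i], trading a point of positive rank for at
    most [n] points of lower rank decreases the total weight, keeps the set
    generating, and adds at most [n - 1] points. Extract an irredundant basis and
    repeat while its size is at most [i]: the process cannot end with all ranks
    zero, because a generating subset of [B] is [B]. So it ends with an
    irredundant basis of size between [i + 1] and [i + n - 1]. *)
Require Import Defs.
From mathcomp Require Import all_boot.
From mathcomp Require Import finmap zify.
From mathcomp Require Import boolp classical_sets functions cardinality.

Local Open Scope classical_set_scope.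

(** The classical structure gives decidable equality, so that points can be listed, removed and
    deduplicated. *)
Definition point {S : Type} (A : S -> Type) : choiceType :=
  {classic {s : S & A s}}.

Section FiniteSortedSets.

Context {S : Type} {A : S -> Type}.

Definition mem_ms (X : msub A) (p : point A) : Prop := X (projT1 p) (projT2 p).

Definition ms_of_seq (l : seq (point A)) : msub A :=
  fun s x => (existT A s x : point A) \in l.

Lemma msubsetP (X Y : msub A) :
  msubset X Y <-> forall p, mem_ms X p -> mem_ms Y p.
Proof.
by split=> [XY [s x]|XY s x]; [exact: XY|exact: (XY (existT A s x))].
Qed.

Lemma msub_ext (X Y : msub A) :
  (forall p, mem_ms X p <-> mem_ms Y p) -> X = Y.
Proof.
move=> XY; apply/functional_extensionality_dep => s; apply/funext => x.
exact/propext/(XY (existT A s x)).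
Qed.

Lemma mem_ms_of_seq (l : seq (point A)) p : mem_ms (ms_of_seq l) p <-> p \in l.
Proof. by case: p. Qed.

Lemma card_set_seq (l : seq (point A)) :
  uniq l -> ([set` l] #= `I_(size l))%card.
Proof.
move=> ul.
have <- : [set` seq_fset tt l] = [set` l].
  by apply/seteqP; split=> x /=; rewrite (seq_fsetE tt l).
by apply/card_eq_fsetP; rewrite size_seq_fset undup_id.
Qed.

Lemma mstotal_of_seq (l : seq (point A)) : mstotal (ms_of_seq l) = [set` l].
Proof. by apply/seteqP; split=> -[]. Qed.

Lemma finite_ms_of_seq (X : msub A) :
  finite_set (mstotal X) -> exists2 l, uniq l & X = ms_of_seq l.
Proof.
move=> /(@finite_seqP (point A))[l Xl].
exists (undup l); first exact: undup_uniq.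
apply: msub_ext => p; rewrite mem_ms_of_seq mem_undup.
by have : mstotal X p <-> p \in l by rewrite Xl.
Qed.

Lemma mscard_eq_of_seq (l : seq (point A)) :
  uniq l -> mscard_eq (ms_of_seq l) (size l).
Proof.
by move=> ul; rewrite /mscard_eq mstotal_of_seq; exact: card_set_seq.
Qed.

Lemma mscard_eqP (X : msub A) k :
  mscard_eq X k <-> exists l, [/\ uniq l, X = ms_of_seq l & size l = k].
Proof.
split=> [Xk|[l [ul -> <-]]]; last exact: mscard_eq_of_seq.
have [|l ul Xl] := finite_ms_of_seq X; first by exists k.
exists l; split=> //; apply/card_eq_II.
move: Xk (mscard_eq_of_seq l ul); rewrite /mscard_eq Xl => Xk lk.
exact: card_eq_trans (card_esym lk) Xk.
Qed.

Lemma mscard_leP (X : msub A) k :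
  mscard_le X k -> exists l, X = ms_of_seq l /\ size l <= k.
Proof.
move=> Xk; have [|l ul Xl] := finite_ms_of_seq X.
  exact: card_le_finite Xk (finite_II k).
exists l; split=> //; rewrite -card_le_II.
move: Xk (mscard_eq_of_seq l ul); rewrite /mscard_le /mscard_eq Xl => Xk lk.
by rewrite -(card_le_eql lk).
Qed.

End FiniteSortedSets.

Section IrredundantBases.

Context {S : Type} {A : S -> Type} {J : msub A -> msub A}.
Context (HJ : ms_closure J).

Lemma closure_sub (X Y : msub A) : msubset X (J Y) -> msubset (J X) (J Y).
Proof. by move=> /(ms_isotone HJ); rewrite (ms_idempotent HJ). Qed.

Lemma basis_sub (X Y : msub A) : basis J X -> msubset X (J Y) -> basis J Y.
Proof.
rewrite /basis => XT XY; apply: msub_ext => p; split=> // _.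
by apply: (closure_sub _ _ XY); rewrite XT.
Qed.

(** A redundant point lies in the closure of the others, so the others generate all of [l]. *)
Lemma basis_rem (l : seq (point A)) : uniq l -> basis J (ms_of_seq l) ->
  ~ irredundant J (ms_of_seq l) ->
  exists2 p, p \in l & basis J (ms_of_seq (rem p l)).
Proof.
move=> ul bl /existsNP[s /existsNP[x /not_implyP[xl /contrapT Jx]]].
pose p : point A := existT A s x; exists p => //.
apply: basis_sub bl _; apply/msubsetP => q ql.
have subJ : msubset (msdiff (ms_of_seq l) (delta x)) (J (ms_of_seq (rem p l))).
  apply/msubsetP => r [rl rp]; apply: ms_extensive => //.
  apply/mem_ms_of_seq; rewrite mem_rem_uniq // inE.
  apply/andP; split; last exact/mem_ms_of_seq.
  by apply/eqP => rE; apply: rp; rewrite rE.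
have [->|qp] := eqVneq q p; first exact: (closure_sub _ _ subJ).
apply: ms_extensive => //; apply/mem_ms_of_seq.
by rewrite mem_rem_uniq // inE qp; apply/mem_ms_of_seq.
Qed.

(** Redundant points are deleted one by one. As the outcome is a [subseq], neither size nor weight
    can grow. *)
Lemma irredundant_subseq (l : seq (point A)) : uniq l ->
  basis J (ms_of_seq l) ->
  exists2 l', subseq l' l & irredundant_basis J (ms_of_seq l').
Proof.
have [m] := ubnP (size l); elim: m l => // m IHm l lm ul bl.
have [il|il] := pselect (irredundant J (ms_of_seq l)); first by exists l.
have [p pl bp] := basis_rem l ul bl il.
have [|l' l'p il'] := IHm (rem p l) _ (rem_uniq p ul) bp.
  by rewrite size_rem //; case: l pl lm {ul bl il bp}.
by exists l' => //; exact: subseq_trans l'p (rem_subseq p l).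
Qed.

Lemma basis_exchange (l l' : seq (point A)) p : uniq l ->
  basis J (ms_of_seq l) -> mem_ms (J (ms_of_seq l')) p ->
  basis J (ms_of_seq (undup (rem p l ++ l'))).
Proof.
move=> ul bl Jp; apply: basis_sub bl _; apply/msubsetP => q ql.
have [->|qp] := eqVneq q p.
  apply: ms_isotone (Jp) => //.
  apply/msubsetP => r /mem_ms_of_seq rl'; apply/mem_ms_of_seq.
  by rewrite mem_undup mem_cat rl' orbT.
apply: ms_extensive => //; apply/mem_ms_of_seq; rewrite mem_undup mem_cat.
by rewrite mem_rem_uniq // inE qp; apply/orP; left; apply/mem_ms_of_seq.
Qed.

(** If [y] in [Y] were missing from [X], then [X] would lie in [Y] without [y], whose closure would
    be everything and contain [y]. *)
Lemma irredundant_basis_sub (X Y : msub A) :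
  irredundant J Y -> basis J X -> msubset X Y -> X = Y.
Proof.
move=> iY bX XY; apply: msub_ext => -[s y]; split=> [/XY //|Yy].
apply: contrapT => Xy; apply: (iY s y Yy).
suff /(ms_isotone HJ) : msubset X (msdiff Y (delta y)) by apply; rewrite bX.
apply/msubsetP => q Xq; split; first exact: XY.
by move=> /= qy; apply: Xy; rewrite -qy; case: q Xq {qy}.
Qed.

(** The rank of [p] is the least [m] whose iterate from [B] contains [p]; one exists because these
    iterates have union [J B]. *)
Lemma ms_rank (n : nat) (B : msub A) : n_ary n J -> basis J B ->
  exists r : point A -> nat, forall p,
    if r p is k.+1 then
      exists l, [/\ size l <= n, {in l, forall q, r q <= k} &
                 mem_ms (J (ms_of_seq l)) p]
    else mem_ms B p.
Proof.
move=> Jn bB; pose reached p m := `[< mem_ms (iter m (J_le J n) B) p >].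
have reachedE p : exists m, reached p m.
  have : mem_ms (J B) p by rewrite bB.
  by rewrite Jn => -[m _ pm]; exists m; apply/asboolP.
exists (fun p => ex_minn (reachedE p)) => p.
case: ex_minnP => -[|k] /asboolP; first by [].
move=> [Y [/msubsetP Yk /mscard_leP[l [Yl ln]]] pY] _.
exists l; split=> // [q ql|]; last by rewrite -Yl.
(* [q] is already in the [k]-th iterate, so its least index is at most [k]. *)
case: ex_minnP => m _; apply; apply/asboolP/Yk.
by rewrite Yl; apply/mem_ms_of_seq.
Qed.

(** The size found need not be below [j]: the basis [B] only defines the ranks and is too large to
    equal a list of size at most [i]. *)
Lemma irredundant_basis_step (n i j : nat) : n_ary n J -> i < j ->
  IrB J i -> IrB J j -> exists2 k, i < k < i + n & IrB J k.
Proof.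
move=> Jn ij [X [iX Xi]] [B [[iB bB] Bj]].
have [l0 [ul0 Xl0 sl0]] := (mscard_eqP _ _).1 Xi; rewrite Xl0 in iX.
have [r rP] := ms_rank n B Jn bB.
pose weight (l : seq (point A)) := \sum_(p <- l) n.+1 ^ r p.
have weight_subseq l l' : subseq l l' -> weight l <= weight l'.
  move=> /perm_to_subseq[l'' l'E].
  by rewrite /weight (perm_big _ l'E) big_cat leq_addr.
suff loop w l : weight l < w -> uniq l -> size l <= i ->
    basis J (ms_of_seq l) -> exists2 k, i < k < i + n & IrB J k.
  by apply: (loop (weight l0).+1 l0) => //; [rewrite sl0|case: iX].
elim: w l => // w IHw l lw ul li bl.
have [l_pos|l_0] := boolP (has (fun p => 0 < r p) l); last first.
  have lB : ms_of_seq l = B.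
    apply: irredundant_basis_sub => //; apply/msubsetP => p /mem_ms_of_seq pl.
    by have := rP p; have /hasPn/(_ p pl) := l_0; case: (r p).
  move: Bj; rewrite -lB => lj.
  have /card_eq_II := card_eq_trans (card_esym (mscard_eq_of_seq l ul)) lj.
  by move=> lj'; move: li; rewrite lj' leqNgt ij.
have [p pl] := hasP l_pos; move: (rP p); case Erp: (r p) => [//|k].
move=> [l1 [l1n l1k Jp]] _.
pose l2 := undup (rem p l ++ l1).
have bl2 : basis J (ms_of_seq l2) by exact: basis_exchange.
have ul2 : uniq l2 by exact: undup_uniq.
(* One point leaves and at most [n] enter: at most [i - 1 + n] remain. *)
have sl2 : size l2 < i + n.
  have := size_undup (rem p l ++ l1); rewrite -/l2 size_cat size_rem //.
  have : 0 < size l by case: (l) pl.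
  by move: l1n li; move: (size l) (size l1) (size l2); lia.
(* The new points weigh at most [n * n.+1 ^ k], less than the weight [n.+1 ^ k.+1] of [p]. *)
have wl2 : weight l2 < weight l.
  have /leq_ltn_trans -> // := weight_subseq _ _ (undup_subseq (rem p l ++ l1)).
  rewrite /weight big_cat /= (perm_big _ (perm_to_rem pl)) /= big_cons addnC.
  rewrite ltn_add2r Erp expnS.
  have : \sum_(q <- l1) n.+1 ^ r q <= size l1 * n.+1 ^ k.
    rewrite -sum1_size big_distrl /= !big_seq; apply: leq_sum => q ql1.
    by rewrite mul1n leq_pexp2l // l1k.
  move=> /leq_ltn_trans; apply.
  by rewrite ltn_mul2r expn_gt0 /= ltnS.
have [l3 l32 il3] := irredundant_subseq l2 ul2 bl2.
have ul3 := subseq_uniq l32 ul2.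
have [l3i|il3'] := leqP (size l3) i.
  apply: (IHw l3) => //; last by case: il3.
  by apply: leq_ltn_trans (weight_subseq _ _ l32) _; apply: leq_trans wl2 _.
exists (size l3); last first.
  by exists (ms_of_seq l3); split=> //; exact: mscard_eq_of_seq.
by rewrite il3' (leq_ltn_trans (size_subseq l32)).
Qed.

End IrredundantBases.

Theorem theorem4p1 (S : Type) (A : S -> Type) (J : msub A -> msub A) (n : nat)
    (HJ : ms_closure J) (n_ge2 : 2 <= n) (Jn : n_ary n J) :
  (forall i j : nat, i < j -> IrB J i -> IrB J j ->
     [set k : nat | i + 1 <= k <= j - 1] `&` IrB J = set0 ->
     j - i <= n - 1)
  /\ (n = 2 -> nat_convex (IrB J)).
Proof.
split=> [i j ij Bi Bj gap|n2 i j k Bi Bj /andP[]].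
  have [k /andP[ik kin] Bk] := irredundant_basis_step HJ n i j Jn ij Bi Bj.
  (* Either [j <= k < i + n] gives the bound, or [k] falls in the gap. *)
  have [jk|kj] := leqP j k; first by lia.
  have : set0 k by rewrite -gap; split=> //=; lia.
  by [].
elim: k => [|k IHk] ik kj; first by move: ik; rewrite leqn0 => /eqP <-.
have [ik'|ki] := leqP i k; last first.
  by have <- : i = k.+1 by lia.
have Bk := IHk ik' (ltnW kj).
(* For [n = 2] the window [k < m < k + 2] leaves only [k.+1]. *)
have [m mk Bm] := irredundant_basis_step HJ n k j Jn kj Bk Bj.
by have <- : m = k.+1 by lia.
Qed.
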